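(* Let $\Theta$ be a unicritical finite Blaschke product with $\deg\Theta=3$. Then for every polynomial $p\in\mathbb{C}[z]$, $$\|p(S_\Theta)\|\le \frac{\sqrt{13+\sqrt{41}}}{2}\,\max_{z\in W(S_\Theta)}|p(z)|.$$
   Context: $\mathbb{D}$ is the open unit disk and $\mathbb{T}$ the unit circle. A unicritical finite Blaschke product of degree $3$ is a function $\Theta(z)=\lambda\left(\frac{z-z_0}{1-\bar z_0 z}\right)^3$ with $z_0\in\mathbb{D}$, $\lambda\in\mathbb{T}$. For a finite Blaschke product $\Theta$, $K_\Theta = H^2\ominus \Theta H^2$, where $H^2=H^2(\mathbb{D})$ is the Hardy space; $\dim K_\Theta=\deg\Theta$. The compression of the shift is $S_\Theta = P_\Theta M_z|_{K_\Theta}$, where $P_\Theta$ is the orthogonal projection of $H^2$ onto $K_\Theta$ and $M_z$ is multiplication by $z$. The numerical range of an operator $A$ is $W(A)=\{\langle Ax,x\rangle : \|x\|=1\}$, and $\|\cdot\|$ is the operator norm. *)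

(* Defs.v *)
From HB Require Import structures.
From mathcomp Require Import all_boot all_order all_algebra.
From mathcomp Require Import all_classical all_reals all_analysis.
From mathcomp Require Import complex.

Set Implicit Arguments.
Unset Strict Implicit.
Unset Printing Implicit Defensive.

Import Order.TTheory GRing.Theory Num.Theory numFieldNormedType.Exports.

Local Open Scope classical_set_scope.
Local Open Scope ring_scope.
Local Open Scope complex_scope.

Section HardySpace.
Variable R : realType.
Notation C := R[i].

(* On R[i] the norm `|z| is itself an element of R[i]; this is its value in R. *)
Definition cabs (z : C) : R := complex.Re `|z|.

(* The topology of the complex numbers is found through the alias R[i]^o. *)
Definition csum (u : nat -> C) : C := limn (series (u : nat -> C^o)).

Definition disk : set C := [set z | `|z| < 1].

(* An element f of H^2 is represented by its sequence of Taylor coefficients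
   at 0: H^2 is the space of the f(z) = \sum_n f_n z^n on the disk with
   \sum_n |f_n|^2 finite, with inner product \sum_n f_n (g_n)^*. *)
Definition hardy : set (nat -> C) :=
  [set f | cvgn (series (fun n => cabs (f n) ^+ 2))].

Definition heval (f : nat -> C) (z : C) : C := csum (fun n => f n * z ^+ n).

Definition hdot (f g : nat -> C) : C := csum (fun n => f n * (g n)^*).

Definition hnorm (f : nat -> C) : R :=
  Num.sqrt (limn (series (fun n => cabs (f n) ^+ 2))).

(* M_z, on Taylor coefficients: (f_0, f_1, ...) |-> (0, f_0, f_1, ...). *)
Definition mulz (f : nat -> C) (n : nat) : C :=
  if n is m.+1 then f m else 0.

Definition mul_image (Theta : C -> C) : set (nat -> C) :=
  [set g | hardy g /\ exists2 h, hardy h &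
    forall z, disk z -> heval g z = Theta z * heval h z].

Definition model_space (Theta : C -> C) : set (nat -> C) :=
  [set f | hardy f /\ forall g, mul_image Theta g -> hdot f g = 0].

(* The value is meaningful (and unique) for f in H^2 and K a closed subspace;
   it is 0 by convention if no orthogonal projection exists. *)
Definition orthoproj (K : set (nat -> C)) (f : nat -> C) : nat -> C :=
  xget (fun=> 0)
    [set g | K g /\ forall h, K h -> hdot (fun n => f n - g n) h = 0].

Definition compressed_shift (Theta : C -> C) (f : nat -> C) : nat -> C :=
  orthoproj (model_space Theta) (mulz f).

Definition poly_op (p : {poly C}) (A : (nat -> C) -> nat -> C)
    (f : nat -> C) : nat -> C :=
  fun n => \sum_(k < size p) p`_k * iter k A f n.

Definition numerical_range (K : set (nat -> C)) (A : (nat -> C) -> nat -> C) :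
    set C :=
  [set hdot (A f) f | f in [set f | K f /\ hnorm f = 1]].

Definition opnorm (K : set (nat -> C)) (A : (nat -> C) -> nat -> C) : \bar R :=
  ereal_sup [set (hnorm (A f))%:E | f in [set f | K f /\ hnorm f <= 1]].

(* A function is given by its values on the disk only. *)
Definition unicritical_blaschke (d : nat) (Theta : C -> C) : Prop :=
  exists z0 lambda : C, [/\ disk z0, `|lambda| = 1 &
    forall z, disk z ->
      Theta z = lambda * ((z - z0) / (1 - z0^* * z)) ^+ d].

Definition is_max (A : set R) (M : R) : Prop := A M /\ ubound A M.

End HardySpace.

(* Main.v *)
Require Import Defs.
From mathcomp Require Import all_boot all_order all_algebra.
From mathcomp Require Import cyclic separable cyclotomic.
From mathcomp Require Import all_classical all_reals all_analysis.
From mathcomp Require Import complex.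
From mathcomp Require Import ring lra.
Import Order.TTheory GRing.Theory Num.Theory numFieldNormedType.Exports.
Local Open Scope classical_set_scope.
Local Open Scope ring_scope.
Local Open Scope complex_scope.

(** Write [S] for the shift and let [a] be the zero of [Theta]. The model space is the kernel of
    [(S^* - conj a)^3]; it has the orthonormal basis [e_j = s (S - a)^j (1 - conj a S)^-(j+1) 1],
    [s^2 = 1 - |a|^2], in which the compressed shift is [a + s^2 (N - conj a N^2)], [N e_j = e_(j+1)].
    - The unit vector [(1/2, w / sqrt 2, w^2 / 2)] with [|w| = 1] shows that the curve
      [kappa z = a + s^2 (z / sqrt 2 - conj a z^2 / 4)], [z = w^*], lies in the numerical range, so
      [q = p o kappa] is bounded on the unit circle by the maximum of [|p|].
    - The compressed shift is also [X (kappa N) X^-1], where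
      [X = diag (1, sqrt 2, 2) - (conj a / sqrt 2) E_21] satisfies [|x| <= |X x| <= c |x|],
      [c^2 = (13 + sqrt 41) / 4]. Hence [|p(S_Theta)| <= c |q(N)|].
    - [q(N)] is multiplication by [q] on polynomials modulo [z^3], so [|q(N)|] is at most the
      maximum of [|q|] on the circle, by Parseval at the roots of unity of a large order. *)

Local Notation Re := complex.Re.
Local Notation Im := complex.Im.
(* In [complex_scope] this notation would otherwise denote [conjc]. *)
Local Notation "z ^*" := (Num.conj z) : complex_scope.

(** * Complex series through their real and imaginary parts *)

Section ComplexSeries.
Variable R : realType.
Notation C := R[i].
Implicit Types (f g h u v : nat -> C) (z w c : C).

Lemma cabs_sqr z : cabs z ^+ 2 = Re z ^+ 2 + Im z ^+ 2.
Proof. by rewrite /cabs normc_def /= sqr_sqrtr // addr_ge0 // sqr_ge0. Qed.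

Lemma cabs_ge0 z : 0 <= cabs z.
Proof. by rewrite /cabs normc_def /= sqrtr_ge0. Qed.

Lemma normC_cabs z : `|z| = (cabs z)%:C.
Proof. by rewrite /cabs normc_def. Qed.

Lemma cabsM z w : cabs (z * w) = cabs z * cabs w.
Proof.
apply: complexI; rewrite -normC_cabs normrM !normC_cabs.
by rewrite -[RHS]/((real_complex R) _) rmorphM.
Qed.

Lemma mul_conj z : z * z^* = (cabs z ^+ 2)%:C.
Proof. by rewrite -sqr_normc normC_cabs -rmorphXn. Qed.

Lemma Re_sum (I : Type) (r : seq I) (P : pred I) (F : I -> C) :
  Re (\sum_(i <- r | P i) F i) = \sum_(i <- r | P i) Re (F i).
Proof. by apply: (big_morph (@complex.Re R)) => // -[? ?] [? ?]. Qed.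

Lemma Im_sum (I : Type) (r : seq I) (P : pred I) (F : I -> C) :
  Im (\sum_(i <- r | P i) F i) = \sum_(i <- r | P i) Im (F i).
Proof. by apply: (big_morph (@complex.Im R)) => // -[? ?] [? ?]. Qed.

Lemma cvg_complex_series u (x y : R) :
  series (fun n => Re (u n)) @ \oo --> x ->
  series (fun n => Im (u n)) @ \oo --> y ->
  series (u : nat -> C^o) @ \oo --> (x +i* y : C^o).
Proof.
move=> /cvgrPdist_lt cx /cvgrPdist_lt cy; apply/cvgrPdist_lt => -[e e'].
(* A positive element of [R[i]] is real, so the radius is [e] alone; each part is given [e / 2]. *)
rewrite ltcE /= => /andP[/eqP e'0 e0]; have e20 : 0 < e / 2 by rewrite divr_gt0.
have := cx _ e20; have := cy _ e20; apply: filterS2 => n Hy Hx.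
rewrite e'0 normc_def ltcE /= eqxx /=.
have -> : Re ((x +i* y) - series u n) = x - series (fun n => Re (u n)) n.
  by rewrite /series /= -Re_sum; case: (\sum_(_ <= _ < _) _).
have -> : Im ((x +i* y) - series u n) = y - series (fun n => Im (u n)) n.
  by rewrite /series /= -Im_sum; case: (\sum_(_ <= _ < _) _).
set p := x - _ in Hx *; set q := y - _ in Hy *.
rewrite -(ltr_pXn2r (n := 2)) ?nnegrE ?sqrtr_ge0 ?(ltW e0) //.
rewrite sqr_sqrtr ?addr_ge0 ?sqr_ge0 // -(real_normK (num_real p)).
rewrite -(real_normK (num_real q)).
have := normr_ge0 p; have := normr_ge0 q; nra.
Qed.

Lemma csum_ReIm u :
  cvgn (series (fun n => Re (u n))) -> cvgn (series (fun n => Im (u n))) ->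
  csum u = limn (series (fun n => Re (u n)))
           +i* limn (series (fun n => Im (u n))).
Proof.
move=> cx cy; rewrite /csum.
by apply: (@cvg_lim C^o); [exact: norm_hausdorff | exact: cvg_complex_series].
Qed.

Lemma bounded_nneg_series (u : nat -> R) (B : R) :
  (forall n, 0 <= u n) -> (forall n, series u n <= B) -> cvgn (series u).
Proof.
move=> u0 uB; apply: nondecreasing_is_cvgn; last first.
  by exists B => _ [n _ <-].
by apply: nondecreasing_series => n _ _.
Qed.

Lemma abs_le_cvg (u v : nat -> R) :
  (forall n, `|u n| <= v n) -> cvgn (series v) -> cvgn (series u).
Proof.
move=> uv cv; apply: normed_cvg; apply: series_le_cvg cv => n //=.
exact: le_trans (normr_ge0 (u n)) (uv n).
Qed.

End ComplexSeries.

(** * The inner product of [H^2] *)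

Section Hardy.
Variable R : realType.
Notation C := R[i].
Implicit Types (f g h u v : nat -> C) (z w c : C).

(** Termwise comparison through [|x + y|^2 <= 2 |x|^2 + 2 |y|^2]. *)
Lemma hardyD f g : hardy f -> hardy g -> hardy (f + g).
Proof.
move=> hf hg; rewrite /hardy /=.
apply: (@series_le_cvg _ _ ((fun n => cabs (f n) ^+ 2 *+ 2) +
   (fun n => cabs (g n) ^+ 2 *+ 2))) => [n|n|n|].
- exact: sqr_ge0.
- by rewrite addr_ge0 // mulrn_wge0 // sqr_ge0.
- rewrite !fctE !cabs_sqr; case: (f n) (g n) => [a b] [c d] /=.
  by have := sqr_ge0 (a - c); have := sqr_ge0 (b - d); nra.
- have tw (k : nat -> C) : cvgn (series (fun n => cabs (k n) ^+ 2)) ->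
      cvgn (series (fun n => cabs (k n) ^+ 2 *+ 2)).
    move=> ck; have -> : (fun n => cabs (k n) ^+ 2 *+ 2) =
      2 *: (fun n => cabs (k n) ^+ 2).
      by apply/funext => n; rewrite fctE /= -mulr_natl.
    exact: is_cvg_seriesZ.
  by apply: is_cvg_seriesD; apply: tw.
Qed.

Lemma hardyZ c f : hardy f -> hardy (c *: f).
Proof.
move=> hf; rewrite /hardy /=.
have -> : (fun n => cabs ((c *: f) n) ^+ 2) =
  (cabs c ^+ 2) *: (fun n => cabs (f n) ^+ 2).
  by apply/funext => n; rewrite -[RHS]/(cabs c ^+ 2 * cabs (f n) ^+ 2) -exprMn -cabsM.
exact: is_cvg_seriesZ.
Qed.

Lemma hardyB f g : hardy f -> hardy g -> hardy (f - g).
Proof. by move=> hf hg; rewrite -scaleN1r; apply/hardyD/hardyZ. Qed.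

Lemma hardy0 : hardy (0 : nat -> C).
Proof.
rewrite /hardy /=; apply: (@bounded_nneg_series _ _ 0) => n; first exact: sqr_ge0.
by rewrite /series /= big1 // => i _; rewrite /cabs normr0 /= expr0n.
Qed.

(** Both parts of [x * conj y] are bounded in absolute value by [|x|^2 + |y|^2], so both series
    converge absolutely. *)
Lemma hardy_sum_cvg f g : hardy f -> hardy g ->
  cvgn (series (fun n => Re (f n * (g n)^*))) /\
  cvgn (series (fun n => Im (f n * (g n)^*))).
Proof.
move=> hf hg; have := is_cvg_seriesD hf hg => cv.
split; apply: abs_le_cvg cv => n; rewrite fctE !cabs_sqr;
  case: (f n) (g n) => [a b] [c d] /=; rewrite ler_norml;
  have := sqr_ge0 (a - c); have := sqr_ge0 (b - d); have := sqr_ge0 (a + c);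
  have := sqr_ge0 (b + d); have := sqr_ge0 (a - d); have := sqr_ge0 (b - c);
  have := sqr_ge0 (a + d); have := sqr_ge0 (b + c);
  move=> *; apply/andP; split; nra.
Qed.

Lemma hdotE f g : hardy f -> hardy g ->
  hdot f g = limn (series (fun n => Re (f n * (g n)^*)))
             +i* limn (series (fun n => Im (f n * (g n)^*))).
Proof. by move=> hf hg; have [] := hardy_sum_cvg _ _ hf hg; apply: csum_ReIm. Qed.

Lemma hdot_cvg f g : hardy f -> hardy g ->
  cvgn (series ((fun n => f n * (g n)^*) : nat -> C^o)).
Proof.
move=> hf hg; have [cx cy] := hardy_sum_cvg _ _ hf hg.
by apply/cvg_ex; eexists; apply: cvg_complex_series; [exact: cx | exact: cy].
Qed.

Lemma hdotDl f g h : hardy f -> hardy g -> hardy h ->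
  hdot (f + g) h = hdot f h + hdot g h.
Proof.
move=> hf hg hh; rewrite /hdot /csum.
have -> : (fun n => (f + g) n * (h n)^*) =
    (fun n => f n * (h n)^* : C^o) + (fun n => g n * (h n)^* : C^o).
  by apply/funext => n; rewrite !fctE mulrDl.
by apply: lim_seriesD; exact: hdot_cvg.
Qed.

Lemma hdotZl c f h : hardy f -> hardy h -> hdot (c *: f) h = c * hdot f h.
Proof.
move=> hf hh; rewrite /hdot /csum.
have -> : (fun n => (c *: f) n * (h n)^*) =
    (c : C^o) *: (fun n => f n * (h n)^* : C^o).
  by apply/funext => n; rewrite -[LHS]/(c * f n * (h n)^*) -mulrA.
by apply: lim_seriesZ; exact: hdot_cvg.
Qed.

Lemma hdotC f g : hardy f -> hardy g -> hdot g f = (hdot f g)^*.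
Proof.
move=> hf hg; rewrite !hdotE //=; congr (_ +i* _).
  congr (limn (series _)); apply/funext => n.
  by case: (f n) (g n) => [a b] [c d] /=; rewrite !mulrN !opprK mulrC [b * _]mulrC.
rewrite -lim_seriesN; last by case: (hardy_sum_cvg _ _ hf hg).
congr (limn (series _)); apply/funext => n; rewrite fctE /=.
by case: (f n) (g n) => [a b] [c d] /=; rewrite !mulrN; ring.
Qed.

Lemma hdotDr f g h : hardy f -> hardy g -> hardy h ->
  hdot h (f + g) = hdot h f + hdot h g.
Proof.
move=> hf hg hh; rewrite (hdotC (f + g)) ?(hdotC f) ?(hdotC g) ?hdotDl //.
  exact: rmorphD.
exact: hardyD.
Qed.

Lemma hdotZr c f h : hardy f -> hardy h -> hdot h (c *: f) = c^* * hdot h f.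
Proof.
move=> hf hh; rewrite (hdotC (c *: f)) ?(hdotC f) ?hdotZl //.
  exact: rmorphM.
exact: hardyZ.
Qed.

Lemma hdotBl f g h : hardy f -> hardy g -> hardy h ->
  hdot (f - g) h = hdot f h - hdot g h.
Proof.
by move=> *; rewrite -scaleN1r hdotDl ?hdotZl ?mulN1r //; exact: hardyZ.
Qed.

Lemma hdotBr f g h : hardy f -> hardy g -> hardy h ->
  hdot h (f - g) = hdot h f - hdot h g.
Proof.
move=> hf hg hh; rewrite (hdotC (f - g)) ?(hdotC f) ?(hdotC g) ?hdotBl //.
  exact: rmorphB.
exact: hardyB.
Qed.

Lemma hdot_norm f : hardy f ->
  hdot f f = (limn (series (fun n => cabs (f n) ^+ 2)))%:C.
Proof.
move=> hf; rewrite hdotE //; congr (_ +i* _).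
  by congr (limn (series _)); apply/funext => n; rewrite mul_conj.
apply: cvg_lim => //; apply: cvg_near_cst; apply: nearW => n.
by rewrite /series /= big1 // => i _; rewrite mul_conj.
Qed.

Lemma hnorm_hdot f : hardy f -> hnorm f = Num.sqrt (Re (hdot f f)).
Proof. by move=> hf; rewrite hdot_norm. Qed.

Lemma sqr_norm_ge0 f : 0 <= limn (series (fun n => cabs (f n) ^+ 2)).
Proof.
have [cv|ncv] := pselect (cvgn (series (fun n => cabs (f n) ^+ 2))); last first.
  (* For a divergent series [limn] is the default point, which is [0] in [R]. *)
  by rewrite dvgP.
apply: limr_ge => //; apply: nearW => n.
by apply: sumr_ge0 => i _; exact: sqr_ge0.
Qed.

(** Partial sums of a nonnegative series stay below its limit, so each term is at most [0]. *)
Lemma hdot_eq0 f : hardy f -> hdot f f = 0 -> f = 0.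
Proof.
move=> hf; rewrite hdot_norm // => -[f0]; apply/funext => n.
have nd : nondecreasing_seq (series (fun n => cabs (f n) ^+ 2)).
  by apply: nondecreasing_series => k _ _; exact: sqr_ge0.
have := nondecreasing_cvgn_le nd hf n.+1; rewrite f0 /series /= big_nat_recr //=.
move=> le0; have : cabs (f n) ^+ 2 <= 0.
  by apply: le_trans le0; rewrite lerDr sumr_ge0 // => i _; exact: sqr_ge0.
rewrite le_eqVlt ltNge sqr_ge0 orbF sqrf_eq0 => /eqP cf0.
by apply/eqP; rewrite -normr_eq0 normC_cabs cf0.
Qed.

End Hardy.

(** * Shifts, resolvents and evaluation on the disk *)

Section Shift.
Variable R : realType.
Notation C := R[i].
Implicit Types (f g h u v : nat -> C) (z w c : C).

Definition delta0 (n : nat) : C := (n == 0)%:R.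
Definition tail f (n : nat) : C := f n.+1.
(* [(1 - c S)^-1 f]. *)
Fixpoint resolvent c f (n : nat) : C :=
  if n is m.+1 then f m.+1 + c * resolvent c f m else f 0.
(* The reproducing kernel of H^2: [hdot f (kern z)] is the value of [f] at [z]. *)
Definition kern z (n : nat) : C := z^* ^+ n.

Lemma scale_at c f n : (c *: f) n = c * f n. Proof. by []. Qed.

Lemma mulzZ c f : mulz (c *: f) = c *: mulz f.
Proof. by apply/funext => -[|n] //; rewrite [RHS]scale_at mulr0. Qed.

Lemma resolventK c f : resolvent c f - c *: mulz (resolvent c f) = f.
Proof.
apply/funext => -[|n]; rewrite fctE /=.
  by rewrite -[X in _ - X]/(c * 0) mulr0 subr0.
by rewrite -[X in _ - X]/(c * resolvent c f n) addrK.
Qed.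

Lemma cabs_triangle z w : cabs (z + w) <= cabs z + cabs w.
Proof. by rewrite -lecR rmorphD /= -!normC_cabs; exact: ler_normD. Qed.

Lemma hardyP f :
  hardy f <-> exists B : R, forall n, \sum_(0 <= i < n) cabs (f i) ^+ 2 <= B.
Proof.
split=> [hf|[B fB]]; last first.
  by apply: (@bounded_nneg_series _ _ B) => // n; exact: sqr_ge0.
exists (limn (series (fun n => cabs (f n) ^+ 2))) => n.
by apply: nondecreasing_cvgn_le => //; apply: nondecreasing_series => k _ _;
  exact: sqr_ge0.
Qed.

Lemma hardy_tail f : hardy f -> hardy (tail f).
Proof.
move=> /hardyP[B fB]; apply/hardyP; exists B => n.
apply: le_trans (fB n.+1); rewrite big_nat_recl //= lerDr; exact: sqr_ge0.
Qed.

Lemma cabs0 : cabs (0 : C) = 0.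
Proof. by rewrite /cabs normr0. Qed.

Lemma hardy_mulz f : hardy f -> hardy (mulz f).
Proof.
move=> /hardyP[B fB]; apply/hardyP; exists B => -[|n].
  by apply: le_trans (fB 0); rewrite !big_nil.
by rewrite big_nat_recl //= cabs0 expr0n add0r; exact: fB.
Qed.

Lemma hardy_delta0 : hardy delta0.
Proof.
apply/hardyP; exists 1 => -[|n]; first by rewrite big_nil.
rewrite big_nat_recl //= big1 => [|i _]; last by rewrite /delta0 /= cabs0 expr0n.
by rewrite /delta0 /= /cabs normr1 expr1n addr0.
Qed.

(* Convexity of the square: (X + r Y)^2 <= (1 - r) (X / (1 - r))^2 + r Y^2. *)
Lemma hardy_resolvent c f : cabs c < 1 -> hardy f -> hardy (resolvent c f).
Proof.
move=> c1 /hardyP[B fB]; set r := cabs c in c1.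
have r0 : 0 <= r := cabs_ge0 _ c; have r1 : 0 < 1 - r by rewrite subr_gt0.
have B0 : 0 <= B by have := fB 0; rewrite big_nil.
(* The bound is the fixed point of [x |-> B / (1 - r) + r * x], the recursion that [step] gives for
   the partial sums. *)
apply/hardyP; exists (B / (1 - r) / (1 - r)); elim=> [|n IH].
  by rewrite big_nil !divr_ge0 // ltW.
have step x y : cabs (x + c * y) ^+ 2 <= cabs x ^+ 2 / (1 - r) + r * cabs y ^+ 2.
  apply: (@le_trans _ _ ((cabs x + r * cabs y) ^+ 2)).
    rewrite ler_sqr ?nnegrE ?addr_ge0 ?mulr_ge0 ?cabs_ge0 //.
    by rewrite -cabsM cabs_triangle.
  move: (cabs x) (cabs y) => X Y; rewrite -subr_ge0.
  have -> : X ^+ 2 / (1 - r) + r * Y ^+ 2 - (X + r * Y) ^+ 2 =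
      r * (X - (1 - r) * Y) ^+ 2 / (1 - r) by field; rewrite gt_eqF.
  by apply: divr_ge0 (ltW r1); rewrite mulr_ge0 // sqr_ge0.
rewrite big_nat_recl //=.
have : cabs (f 0) ^+ 2 + \sum_(0 <= i < n) cabs (f i.+1 + c * resolvent c f i) ^+ 2
  <= (\sum_(0 <= i < n.+1) cabs (f i) ^+ 2) / (1 - r)
     + r * \sum_(0 <= i < n) cabs (resolvent c f i) ^+ 2.
  rewrite big_nat_recl //= mulrDl -addrA; apply: lerD.
    by rewrite ler_pdivlMr // mulrBr mulr1 gerBl mulr_ge0 ?sqr_ge0.
  rewrite mulr_suml mulr_sumr -big_split /=.
  by apply: ler_sum => i _.
move/le_trans; apply.
apply: (@le_trans _ _ (B / (1 - r) + r * (B / (1 - r) / (1 - r)))).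
  by apply: lerD; [rewrite ler_pM2r ?invr_gt0 | rewrite ler_wpM2l].
by rewrite le_eqVlt; apply/orP; left; apply/eqP; field; rewrite gt_eqF.
Qed.

Lemma csum_recl u : cvgn (series (tail u : nat -> C^o)) ->
  csum u = u 0 + csum (tail u).
Proof.
move=> cu; rewrite /csum; apply: (@cvg_lim C^o); first exact: norm_hausdorff.
rewrite -cvg_shiftS /=.
have -> : (fun n => series (u : nat -> C^o) n.+1) =
    cst (u 0 : C^o) + series (tail u : nat -> C^o).
  by apply/funext => n; rewrite /series /= big_nat_recl.
by apply: cvgD; [exact: cvg_cst | exact: cu].
Qed.

Lemma hdot_recl f g : hardy f -> hardy g ->
  hdot f g = f 0 * (g 0)^* + hdot (tail f) (tail g).
Proof.
move=> hf hg; rewrite /hdot csum_recl //.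
exact: hdot_cvg (hardy_tail _ hf) (hardy_tail _ hg).
Qed.

Lemma hdot_mulz_l f g : hardy f -> hardy g ->
  hdot (mulz f) g = hdot f (tail g).
Proof. by move=> hf hg; rewrite hdot_recl ?mul0r ?add0r //; exact: hardy_mulz. Qed.

Lemma hdot_mulz f g : hardy f -> hardy g -> hdot (mulz f) (mulz g) = hdot f g.
Proof. by move=> hf hg; rewrite hdot_mulz_l //; exact: hardy_mulz. Qed.

Lemma hdot0l g : hardy g -> hdot 0 g = 0.
Proof. by move=> hg; rewrite -(scale0r (0 : nat -> C)) hdotZl ?mul0r //; exact: hardy0. Qed.

Lemma tail_kern z : tail (kern z) = z^* *: kern z.
Proof. by apply/funext => n; rewrite scale_at /tail /kern exprS. Qed.

Lemma cabs_conj z : cabs z^* = cabs z.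
Proof. by rewrite /cabs normcJ. Qed.

Lemma diskE z : disk z <-> cabs z < 1.
Proof.
by rewrite /disk /= normC_cabs -ltcR; split.
Qed.

Lemma kernE z : kern z = resolvent z^* delta0.
Proof.
by apply/funext; elim=> [|n IH] //=; rewrite -IH /kern exprS add0r.
Qed.

Lemma hardy_kern z : disk z -> hardy (kern z).
Proof.
move=> /diskE z1; rewrite kernE; apply: hardy_resolvent; last exact: hardy_delta0.
by rewrite cabs_conj.
Qed.

Lemma hevalE f z : heval f z = hdot f (kern z).
Proof.
rewrite /heval /hdot; congr csum; apply/funext => n; congr (_ * _).
by rewrite -[RHS]/((kern z n)^*) /kern rmorphXn /= conjCK.
Qed.

Lemma heval_mulz f z : hardy f -> disk z -> heval (mulz f) z = z * heval f z.
Proof.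
move=> hf /hardy_kern hk; rewrite !hevalE hdot_mulz_l // tail_kern hdotZr //.
by rewrite conjCK.
Qed.

Lemma hevalB f g z : hardy f -> hardy g -> disk z ->
  heval (f - g) z = heval f z - heval g z.
Proof. by move=> hf hg /hardy_kern hk; rewrite !hevalE hdotBl. Qed.

Lemma hevalZ c f z : hardy f -> disk z -> heval (c *: f) z = c * heval f z.
Proof. by move=> hf /hardy_kern hk; rewrite !hevalE hdotZl. Qed.

(** The tail of [kern z] is [conj z] times itself, so splitting off the first term gives
    [|k|^2 = 1 + |z|^2 |k|^2]. *)
Lemma hdot_kern z : disk z -> hdot (kern z) (kern z) * (1 - z * z^*) = 1.
Proof.
move=> dz; have hk := hardy_kern _ dz.
have := hdot_recl _ _ hk hk; rewrite tail_kern hdotZl ?hdotZr //; last exact: hardyZ.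
rewrite conjCK {2 3}/kern !expr0 conjC1 mulr1 => e.
by rewrite mulrBr mulr1 {1}e; ring.
Qed.

(** Expansion of [0 <= |f + g|^2]; it stands in for the Cauchy-Schwarz inequality below. *)
Lemma Re_hdot_le f g : hardy f -> hardy g ->
  - (Re (hdot f g) *+ 2) <= Re (hdot f f) + Re (hdot g g).
Proof.
move=> hf hg; have := sqr_norm_ge0 _ (f + g).
have hfg := hardyD _ _ _ hf hg.
have := hdot_norm _ _ hfg; rewrite hdotDl // !hdotDr // (hdotC _ f g) //.
case: (hdot f f) (hdot f g) (hdot g g) => [a b] [c d] [e k] /= [<- _] /=.
lra.
Qed.

(** At a small real [x > 0], [0 = f(x) = f(0) + x * (tail f)(x)], and the last factor stays bounded
    as [x] tends to [0]. The point [0] is left out of the hypothesis because [heval_inj] divides by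
    [z]. *)
Lemma heval_eq0_at0 f : hardy f ->
  (forall z, disk z -> z != 0 -> heval f z = 0) -> f 0 = 0.
Proof.
move=> hf f0; have ht := hardy_tail _ hf.
set a := f 0; set t := a^* *: tail f; have htt : hardy t by apply: hardyZ.
(* [4 / 3] bounds [|kern x|^2 = 1 / (1 - x^2)] for [0 < x <= 1 / 2]. *)
pose B := Re (hdot t t) + 4 / 3.
have small (x : R) : 0 < x -> x <= 1 / 2 -> cabs a ^+ 2 *+ 2 <= x * B.
  move=> x0 x2; have dx : disk x%:C.
    by apply/diskE; rewrite /cabs normc_def /= expr0n addr0 sqrtr_sqr gtr0_norm //; lra.
  have hk := hardy_kern _ dx.
  have := f0 _ dx; rewrite hevalE hdot_recl // tail_kern hdotZr //.
  rewrite conjCK {1}/kern expr0 conjC1 mulr1 => e.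
  have /e {}e : (x%:C : C) != 0 by rewrite eq_complex /= eqxx andbT gt_eqF.
  have e2 : (cabs a ^+ 2)%:C = - (x%:C * hdot t (kern x%:C)).
    rewrite -mul_conj hdotZl //; move: e; rewrite -/a => /eqP.
    by rewrite addr_eq0 => /eqP {1}->; ring.
  have := Re_hdot_le _ _ htt hk; have := hdot_kern _ dx.
  rewrite (hdot_norm _ _ hk) /B; move: e2.
  case: (hdot t t) (hdot t (kern _)) => [T T'] [p q] /= [e2 _] [ek _].
  have kx : limn (series (fun n => cabs (kern x%:C n) ^+ 2)) <= 4 / 3.
    move: (limn _) ek => K ek; have x4 : x ^+ 2 <= 1 / 4 by nra.
    rewrite leNgt; apply/negP => K3; nra.
  by move: (limn _) kx => K kx; nra.
have B0 : 0 < B.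
  by rewrite /B (hdot_norm _ _ htt); have := sqr_norm_ge0 _ t => /=; lra.
have : cabs a ^+ 2 *+ 2 <= 0.
  rewrite leNgt; apply/negP => A0; move: (_ *+ 2) A0 small => A A0 small.
  (* If [x = A / (2 * B)] is allowed it gives [A <= A / 2]; otherwise [A > B], against [A <= B / 2]
     from [x = 1 / 2]. *)
  have [hA|hA] := leP (A / (2 * B)) (1 / 2).
    have : 0 < A / (2 * B) by rewrite divr_gt0 // mulr_gt0.
    move/small => /(_ hA).
    have -> : A / (2 * B) * B = A / 2 by field; rewrite gt_eqF.
    lra.
  have := small (1 / 2); move: hA; rewrite ltr_pdivlMr ?mulr_gt0 //; lra.
rewrite pmulrn_lle0 // le_eqVlt ltNge sqr_ge0 orbF sqrf_eq0 => /eqP ca0.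
by apply/eqP; rewrite -normr_eq0 normC_cabs -/a ca0.
Qed.

(** Induction on the index: once [f 0 = 0], [f] is the shift of its tail, and dividing by [z] passes
    the hypothesis to the tail. *)
Lemma heval_inj f : hardy f -> (forall z, disk z -> heval f z = 0) -> f = 0.
Proof.
move=> hf f0; apply/funext => n.
have {f0} : forall z, disk z -> z != 0 -> heval f z = 0 by move=> z dz _; apply: f0.
elim: n f hf => [|n IH] f hf f0; first exact: heval_eq0_at0.
apply: (IH (tail f)) => [|z dz z0]; first exact: hardy_tail.
have ff : f = mulz (tail f).
  by apply/funext => -[|k] //=; rewrite (heval_eq0_at0 f).
have := f0 _ dz z0; rewrite ff heval_mulz //; last exact: hardy_tail.
by move/eqP; rewrite mulf_eq0 (negPf z0) => /eqP.
Qed.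

End Shift.

Arguments delta0 {R}.
Arguments tail {R}.
Arguments resolvent {R}.
Arguments kern {R}.

(** * The model space as the kernel of [(S^* - conj a)^3] *)

Section ModelSpace.
Variable R : realType.
Notation C := R[i].
Implicit Types (f g h u v : nat -> C) (z w c : C).
Variable a : C.
Hypothesis a_disk : disk a.

Definition shift_sub f : nat -> C := mulz f - a *: f.
Definition sub_shift f : nat -> C := f - a^* *: mulz f.
(* The adjoint of [shift_sub]. *)
Definition back_sub f : nat -> C := tail f - a^* *: f.

Let M := shift_sub.
Let P := sub_shift.
Let L := back_sub.

Lemma hardy_shift_sub f : hardy f -> hardy (M f).
Proof. by move=> hf; apply: hardyB; [exact: hardy_mulz | exact: hardyZ]. Qed.

Lemma hardy_sub_shift f : hardy f -> hardy (P f).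
Proof. by move=> hf; apply: hardyB => //; apply: hardyZ; exact: hardy_mulz. Qed.

Lemma hardy_back_sub f : hardy f -> hardy (L f).
Proof. by move=> hf; apply: hardyB; [exact: hardy_tail | exact: hardyZ]. Qed.

Lemma heval_shift_sub f z : hardy f -> disk z -> heval (M f) z = (z - a) * heval f z.
Proof.
move=> hf dz; rewrite hevalB ?hevalZ ?heval_mulz ?mulrBl //.
  exact: hardy_mulz.
exact: hardyZ.
Qed.

Lemma heval_sub_shift f z : hardy f -> disk z ->
  heval (P f) z = (1 - a^* * z) * heval f z.
Proof.
move=> hf dz; rewrite hevalB ?hevalZ ?heval_mulz ?mulrBl ?mul1r ?mulrA //.
  exact: hardy_mulz.
by apply/hardyZ/hardy_mulz.
Qed.

Lemma hdot_shift_sub f h : hardy f -> hardy h -> hdot f (M h) = hdot (L f) h.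
Proof.
move=> hf hh; have hm := hardy_mulz _ _ hh; have hz := hardyZ _ a _ hh.
rewrite hdotBr ?hdotBl ?hdotZr ?hdotZl //; [|exact: hardy_tail|exact: hardyZ].
by rewrite hdotC // hdot_mulz_l // -hdotC //; exact: hardy_tail.
Qed.

Lemma sub_disk_neq0 z : disk z -> 1 - a^* * z != 0.
Proof.
move=> /diskE z1; move/diskE: a_disk => a1.
apply: contraTneq (ltr_pM (cabs_ge0 _ _) (cabs_ge0 _ _) a1 z1) => /eqP.
rewrite subr_eq0 => /eqP e; rewrite -(cabs_conj _ a) -cabsM -e.
by rewrite /cabs normr1 mulr1 ltxx.
Qed.

Section Theta.
Variables (Theta : C -> C) (lambda : C).
Hypothesis lambda1 : `|lambda| = 1.
Hypothesis ThetaE : forall z, disk z ->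
  Theta z = lambda * ((z - a) / (1 - a^* * z)) ^+ 3.

(** The constant [lambda] and the operator [1 - conj a S] are invertible on [H^2], the latter by
    [resolvent]; hence [Theta H^2 = (S - a)^3 H^2]. *)
Lemma mul_imageE g :
  mul_image Theta g <-> exists2 h, hardy h & g = M (M (M h)).
Proof.
have ll : lambda * lambda^* = 1 by rewrite -normCK lambda1 expr1n.
split=> [[hg [h hh gE]]|[h hh ->]].
  pose r := resolvent a^*.
  have hr f : hardy f -> hardy (r f).
    by move=> hf; apply: hardy_resolvent => //; rewrite cabs_conj; apply/diskE.
  have Pr f : P (r f) = f by exact: resolventK.
  have h1 := hr _ hh; have h2 := hr _ h1; have h3 := hr _ h2.
  pose k := lambda *: r (r (r h)); have hk : hardy k by exact: hardyZ.
  have hk1 := hardy_shift_sub _ hk; have hk2 := hardy_shift_sub _ hk1.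
  have hk3 := hardy_shift_sub _ hk2.
  exists k => //; apply/eqP; rewrite -subr_eq0; apply/eqP.
  apply: heval_inj => [|z dz]; first exact: hardyB.
  rewrite hevalB // !heval_shift_sub // gE // ThetaE // hevalZ //.
  have -> : heval h z = (1 - a^* * z) ^+ 3 * heval (r (r (r h))) z.
    by rewrite -{1}(Pr h) -{1}(Pr (r h)) -{1}(Pr (r (r h)))
      !heval_sub_shift ?Pr //; ring.
  by field; exact: sub_disk_neq0.
have h1 := hardy_shift_sub _ hh; have h2 := hardy_shift_sub _ h1.
split; first exact: hardy_shift_sub.
have k1 := hardy_sub_shift _ hh; have k2 := hardy_sub_shift _ k1.
have k3 := hardy_sub_shift _ k2.
(* The three factors [P] cancel the denominator of [Theta], and [conj lambda] cancels [lambda]. *)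
exists (lambda^* *: P (P (P h))) => [|z dz]; first exact: hardyZ.
rewrite !heval_shift_sub // hevalZ // !heval_sub_shift // ThetaE //.
transitivity (lambda * lambda^* * (z - a) ^+ 3 * heval h z).
  by rewrite ll; ring.
by field; exact: sub_disk_neq0.
Qed.

(** Orthogonality to the range of [M^3] is membership in the kernel of its adjoint [L^3]: testing
    [f] against [M^3 h] with [h = L^3 f] gives [|L^3 f|^2 = 0]. *)
Lemma model_spaceE f : model_space Theta f <-> hardy f /\ L (L (L f)) = 0.
Proof.
have adj h : hardy f -> hardy h -> hdot f (M (M (M h))) = hdot (L (L (L f))) h.
  move=> hf hh; have h1 := hardy_shift_sub _ hh; have h2 := hardy_shift_sub _ h1.
  have f1 := hardy_back_sub _ hf; have f2 := hardy_back_sub _ f1.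
  by rewrite !hdot_shift_sub.
split=> -[hf f0]; split=> //.
  have h3 : hardy (L (L (L f))) by do 3!apply: hardy_back_sub.
  apply: hdot_eq0 => //; rewrite -adj //; apply: f0; apply/mul_imageE.
  by exists (L (L (L f))).
by move=> g /mul_imageE[h hh ->]; rewrite adj // f0 hdot0l.
Qed.

End Theta.

End ModelSpace.

Arguments shift_sub {R}.
Arguments sub_shift {R}.
Arguments back_sub {R}.

(** * The orthonormal basis of the model space *)

Section Basis.
Variable R : realType.
Notation C := R[i].
Implicit Types (f g h : nat -> C) (z w c : C).
Variable a : C.
Hypothesis a_disk : disk a.

(* The coefficients of [(1 - a^* z)^-3]. *)
Definition cubic_kern : nat -> C := resolvent a^* (resolvent a^* (kern a)).
Definition kern_scale : C := (Num.sqrt (1 - cabs a ^+ 2))%:C.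
Local Notation u := cubic_kern.
Local Notation s := kern_scale.

Lemma sqr_s : s * s = 1 - a * a^*.
Proof.
move/diskE: a_disk => a1; rewrite mul_conj /kern_scale -rmorphM /= -expr2 sqr_sqrtr.
  by rewrite rmorphB rmorph1.
by rewrite subr_ge0 expr_le1 ?cabs_ge0 // ltW.
Qed.

Lemma conj_s : s^* = s.
Proof. by apply: conj_Creal; apply/complex_realP; eexists. Qed.

Lemma s_neq0 : s != 0.
Proof.
have := sub_disk_neq0 _ _ a_disk _ a_disk; apply: contraNneq => s0.
by rewrite mulrC -sqr_s s0 mul0r.
Qed.

(** The [e_j] are put over the common denominator [(1 - conj a z)^3] of [u]: each [sub_shift]
    cancels one power of it. *)
Definition emb c0 c1 c2 : nat -> C :=
  c0 *: (s *: sub_shift a (sub_shift a u)) +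
  c1 *: (s *: shift_sub a (sub_shift a u)) +
  c2 *: (s *: shift_sub a (shift_sub a u)).

Lemma add_at f g n : (f + g) n = f n + g n. Proof. by []. Qed.
Lemma opp_at f n : (- f) n = - f n. Proof. by []. Qed.

Let at_ := (add_at, opp_at, scale_at).

Lemma hardy_u1 : hardy (resolvent a^* (kern a)).
Proof.
by apply: hardy_resolvent; [rewrite cabs_conj; apply/diskE | exact: hardy_kern].
Qed.

Lemma hardy_u : hardy u.
Proof.
by apply: hardy_resolvent; [rewrite cabs_conj; apply/diskE | exact: hardy_u1].
Qed.

Lemma u_small : [/\ u 0 = 1, u 1 = 3 * a^* & u 2 = 6 * a^* ^+ 2].
Proof. by rewrite /cubic_kern /= /kern; split; ring. Qed.

Lemma u_rec n :
  u n.+3 = 3 * a^* * u n.+2 - 3 * a^* ^+ 2 * u n.+1 + a^* ^+ 3 * u n.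
Proof. by rewrite /cubic_kern /= /kern !exprS; ring. Qed.

Lemma embE c0 c1 c2 : emb c0 c1 c2 =
  (s * (c0 - a * c1 + a ^+ 2 * c2)) *: u +
  (s * (- 2 * a^* * c0 + (1 + a * a^*) * c1 - 2 * a * c2)) *: mulz u +
  (s * (a^* ^+ 2 * c0 - a^* * c1 + c2)) *: mulz (mulz u).
Proof.
rewrite /emb /shift_sub /sub_shift.
by apply/funext => -[|[|n]]; rewrite ?at_ /= ?at_ /= ?at_ /= ?at_ /=; ring.
Qed.

Lemma hardy_emb c0 c1 c2 : hardy (emb c0 c1 c2).
Proof.
have h0 := hardy_u; have h1 := hardy_mulz _ _ h0.
rewrite embE; apply: hardyD; last by apply/hardyZ/hardy_mulz.
by apply: hardyD; exact: hardyZ.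
Qed.

Lemma back_sub3 f n : back_sub a (back_sub a (back_sub a f)) n =
  f n.+3 - 3 * a^* * f n.+2 + 3 * a^* ^+ 2 * f n.+1 - a^* ^+ 3 * f n.
Proof. by rewrite /back_sub !at_ /tail !at_; ring. Qed.

Lemma back_sub3_emb c0 c1 c2 :
  back_sub a (back_sub a (back_sub a (emb c0 c1 c2))) = 0.
Proof.
rewrite embE; apply/funext => n; rewrite back_sub3 -[RHS]/0.
have [u0 u1 u2] := u_small.
case: n => [|[|n]]; rewrite ?at_ /= ?u_rec ?u0 ?u1 ?u2; ring.
Qed.

(** A sequence in the kernel satisfies a linear recurrence of order three, so it is determined by
    its first three entries, which [emb] can match. *)
Lemma back_sub3_emb_exists f : back_sub a (back_sub a (back_sub a f)) = 0 ->
  exists c0 c1 c2, f = emb c0 c1 c2.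
Proof.
move=> f0; have [u0 u1 u2] := u_small.
(* [q0 + q1 z + q2 z^2] is the numerator of [f] over [(1 - conj a z)^3], read off from the first
   three entries. *)
pose q0 := f 0%N; pose q1 := f 1%N - q0 * u 1%N.
pose q2 := f 2 - q0 * u 2 - q1 * u 1%N.
have s0 := s_neq0; have ss := sqr_s.
(* The matrix of [embE] without its factor [s], multiplied by the same matrix with [a] replaced by
   [- a], is the scalar [(1 - |a|^2)^2 = s^4]. This gives the witnesses. *)
pose k := (s * s * s * s * s)^-1.
exists (k * (q0 + a * q1 + a ^+ 2 * q2)).
exists (k * (2 * a^* * q0 + (1 + a * a^*) * q1 + 2 * a * q2)).
exists (k * (a^* ^+ 2 * q0 + a^* * q1 + q2)).
have -> : emb (k * (q0 + a * q1 + a ^+ 2 * q2))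
     (k * (2 * a^* * q0 + (1 + a * a^*) * q1 + 2 * a * q2))
     (k * (a^* ^+ 2 * q0 + a^* * q1 + q2)) =
   q0 *: u + q1 *: mulz u + q2 *: mulz (mulz u).
  rewrite embE /k; congr (_ *: _ + _ *: _ + _ *: _).
  - transitivity (q0 * (1 - a * a^*) ^+ 2 / (s * s) ^+ 2); last first.
      by rewrite ss; field; rewrite -ss mulf_neq0.
    by field.
  - transitivity (q1 * (1 - a * a^*) ^+ 2 / (s * s) ^+ 2); last first.
      by rewrite ss; field; rewrite -ss mulf_neq0.
    by field.
  - transitivity (q2 * (1 - a * a^*) ^+ 2 / (s * s) ^+ 2); last first.
      by rewrite ss; field; rewrite -ss mulf_neq0.
    by field.
set e := (X in _ = X).
have e0 n : e n.+3 = 3 * a^* * e n.+2 - 3 * a^* ^+ 2 * e n.+1 + a^* ^+ 3 * e n.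
  by rewrite /e; case: n => [|[|n]]; rewrite ?at_ /= ?u_rec ?u0 ?u1 ?u2; ring.
have fr n : f n.+3 = 3 * a^* * f n.+2 - 3 * a^* ^+ 2 * f n.+1 + a^* ^+ 3 * f n.
  have : back_sub a (back_sub a (back_sub a f)) n = 0 by rewrite f0.
  by rewrite back_sub3 => h; rewrite -[LHS]addr0 -[X in _ + X]oppr0 -h; ring.
have e012 : [/\ f 0 = e 0, f 1 = e 1 & f 2 = e 2].
  by rewrite /e !at_ /= /q2 /q1 /q0 u0; split; ring.
apply/funext => n; have [] : [/\ f n = e n, f n.+1 = e n.+1 & f n.+2 = e n.+2].
  elim: n => [//|n [h0 h1 h2]]; split=> //.
  by rewrite fr e0 h0 h1 h2.
by [].
Qed.

(** Since [(S - a) e_2 = s (S - a)^3 u] lies in [Theta H^2], this splits the shifted vector into its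
    parts in the model space and in [Theta H^2]. *)
Lemma mulz_emb c0 c1 c2 : mulz (emb c0 c1 c2) =
  emb (a * c0) (a * c1 + (1 - a * a^*) * c0)
      (a * c2 + (1 - a * a^*) * c1 - (1 - a * a^*) * a^* * c0) +
  (s * (a^* ^+ 2 * c0 - a^* * c1 + c2)) *:
    shift_sub a (shift_sub a (shift_sub a u)).
Proof.
rewrite !embE /shift_sub; apply/funext => -[|[|[|n]]];
  by rewrite ?at_ /= ?at_ /= ?at_ /= ?at_ /=; ring.
Qed.

(** The analogue of [|z - a| = |1 - conj a z|] on the unit circle: a Blaschke factor multiplies
    isometrically. *)
Lemma hdot_shift_sub2 f g : hardy f -> hardy g ->
  hdot (shift_sub a f) (shift_sub a g) = hdot (sub_shift a f) (sub_shift a g).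
Proof.
move=> hf hg; rewrite /shift_sub /sub_shift.
have mf := hardy_mulz _ _ hf; have mg := hardy_mulz _ _ hg.
have af := hardyZ _ a _ hf; have ag := hardyZ _ a _ hg.
have amf := hardyZ _ a^* _ mf; have amg := hardyZ _ a^* _ mg.
have dg := hardyB _ _ _ mg ag; have dg' := hardyB _ _ _ hg amg.
rewrite (hdotBl _ (mulz f)) // (hdotBl _ f) // !(hdotBr _ _ _ _ mg ag) //.
rewrite !(hdotBr _ _ _ _ hg amg) // !hdotZl // !hdotZr // !hdot_mulz // conjCK.
ring.
Qed.

(** [kern a] reproduces values at [a], where [(S - a) h] vanishes; equivalently, the adjoint of
    [S - a] kills it. *)
Lemma hdot_kern_shift_sub h : hardy h -> hdot (kern a) (shift_sub a h) = 0.
Proof.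
move=> hh; rewrite hdot_shift_sub //; last exact: hardy_kern.
have -> : back_sub a (kern a) = 0 by rewrite /back_sub tail_kern subrr.
exact: hdot0l.
Qed.

(** Orthonormality of the [e_j]: common Blaschke factors are removed by [hdot_shift_sub2] until one
    side is [kern a]. What remains is then [0] or [|kern a|^2 = s^-2]. *)
Lemma hdot_emb c0 c1 c2 d0 d1 d2 :
  hdot (emb c0 c1 c2) (emb d0 d1 d2) = c0 * d0^* + c1 * d1^* + c2 * d2^*.
Proof.
have h0 := hardy_kern _ _ a_disk; have h1 := hardy_u1; have h2 := hardy_u.
have P2 : sub_shift a u = resolvent a^* (kern a) by exact: resolventK.
have P1 : sub_shift a (resolvent a^* (kern a)) = kern a by exact: resolventK.
set u1 := resolvent a^* (kern a) in h1 P1 P2.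
have m1 := hardy_shift_sub _ a _ h1; have m2 := hardy_shift_sub _ a _ h2.
have m3 := hardy_shift_sub _ a _ m2.
have comm : sub_shift a (shift_sub a u) = shift_sub a u1.
  rewrite -P2 /sub_shift /shift_sub.
  by apply/funext => -[|[|n]]; rewrite ?at_ /= ?at_ /= ?at_ /= ?at_ /=; ring.
have k00 : hdot (kern a) (kern a) = (s * s)^-1.
  have ss0 : s * s != 0 by rewrite mulf_neq0 ?s_neq0.
  by apply: (mulIf ss0); rewrite mulVf // sqr_s hdot_kern.
have k01 := hdot_kern_shift_sub _ h1.
have k02 := hdot_kern_shift_sub _ m2.
have k10 : hdot (shift_sub a u1) (kern a) = 0 by rewrite hdotC // k01 conjC0.
have k20 : hdot (shift_sub a (shift_sub a u)) (kern a) = 0.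
  by rewrite hdotC // k02 conjC0.
have k11 : hdot (shift_sub a u1) (shift_sub a u1) = (s * s)^-1.
  by rewrite hdot_shift_sub2 // P1.
have k12 : hdot (shift_sub a u1) (shift_sub a (shift_sub a u)) = 0.
  by rewrite hdot_shift_sub2 // P1 comm.
have k21 : hdot (shift_sub a (shift_sub a u)) (shift_sub a u1) = 0.
  by rewrite hdotC // k12 conjC0.
have k22 : hdot (shift_sub a (shift_sub a u)) (shift_sub a (shift_sub a u)) =
    (s * s)^-1.
  by rewrite hdot_shift_sub2 // comm.
rewrite /emb P2 P1.
have sc f g : hardy f -> hardy g -> hdot (s *: f) (s *: g) = s * s * hdot f g.
  by move=> hf hg; rewrite hdotZl ?hdotZr ?conj_s ?mulrA //; exact: hardyZ.
move: (sc _ _ h0 h0) (sc _ _ h0 m1) (sc _ _ h0 m3) (sc _ _ m1 h0) (sc _ _ m1 m1).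
move: (sc _ _ m1 m3) (sc _ _ m3 h0) (sc _ _ m3 m1) (sc _ _ m3 m3).
rewrite k00 k01 k02 k10 k11 k12 k20 k21 k22 mulr0 divff ?mulf_neq0 ?s_neq0 //.
move: (hardyZ _ s _ h0) (hardyZ _ s _ m1) (hardyZ _ s _ m3).
move: (s *: kern a) (s *: shift_sub a u1) (s *: shift_sub a (shift_sub a u)) => e0 e1 e2.
move=> he0 he1 he2 g22 g21 g20 g12 g11 g10 g02 g01 g00.
have z0 c := hardyZ _ c _ he0; have z1 c := hardyZ _ c _ he1.
have z2 c := hardyZ _ c _ he2; have z01 c d := hardyD _ _ _ (z0 c) (z1 d).
have z012 c d b := hardyD _ _ _ (z01 c d) (z2 b).
have dl g : hardy g -> hdot (c0 *: e0 + c1 *: e1 + c2 *: e2) g =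
    c0 * hdot e0 g + c1 * hdot e1 g + c2 * hdot e2 g.
  move=> hg; rewrite (hdotDl _ _ _ _ (z01 c0 c1) (z2 c2) hg).
  by rewrite (hdotDl _ _ _ _ (z0 c0) (z1 c1) hg) !hdotZl.
have dr f : hardy f -> hdot f (d0 *: e0 + d1 *: e1 + d2 *: e2) =
    d0^* * hdot f e0 + d1^* * hdot f e1 + d2^* * hdot f e2.
  move=> hf; rewrite (hdotDr _ _ _ _ (z01 d0 d1) (z2 d2) hf).
  by rewrite (hdotDr _ _ _ _ (z0 d0) (z1 d1) hf) !hdotZr.
rewrite dl; last exact: z012.
by rewrite !dr // g22 g21 g20 g12 g11 g10 g02 g01 g00; ring.
Qed.

End Basis.

Arguments emb {R}.
Arguments cubic_kern {R}.
Arguments kern_scale {R}.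

(** * Parseval at roots of unity and the bound for multiplication modulo [z^d] *)

Lemma prim_root_exists (F : numClosedFieldType) (n : nat) :
  (0 < n)%N -> exists z : F, n.-primitive_root z.
Proof.
move=> n0; have n0F : (n%:R : F) != 0 by rewrite pnatr_eq0 -lt0n.
pose p : {poly F} := 'X^n - 1.
have [r Dp] := closed_field_poly_normal p.
move: Dp; rewrite (monicP _) ?monicXnsubC // scale1r => Dp.
have rn : all n.-unity_root r by apply/allP => z; rewrite -root_prod_XsubC -Dp.
have sz : (n < (size r).+1)%N by rewrite -(size_prod_XsubC r id) -Dp size_XnsubC.
(* As [n] is nonzero in [F], [X^n - 1] is separable, so it has [n] distinct roots; one of them must
   be primitive. *)
have ur : uniq r by rewrite -separable_prod_XsubC -Dp separable_Xn_sub_1.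
by have /hasP[z _ zn] := has_prim_root n0 rn ur sz; exists z.
Qed.

Section Parseval.
Variable R : realType.
Notation C := R[i].
Implicit Types (z w : C) (p q r : {poly C}).

Lemma prim_root_conj (n : nat) z : (0 < n)%N -> n.-primitive_root z ->
  `|z| = 1 /\ z^* = z^-1.
Proof.
move=> n0 zn; have z1 : `|z| = 1.
  apply/eqP; rewrite -(pexpr_eq1 n0) // -normrX.
  by rewrite (prim_expr_order zn) normr1.
split=> //; have z0 : z != 0 by rewrite -normr_eq0 z1 oner_eq0.
by apply: (mulfI z0); rewrite divff // -normCK z1 expr1n.
Qed.

Lemma sum_prim_root (n : nat) z (i j : 'I_n) : n.-primitive_root z ->
  \sum_(k < n) (z ^+ k) ^+ i * ((z ^+ k) ^+ j)^* = (i == j)%:R * n%:R.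
Proof.
move=> zn; have n0 : (0 < n)%N := prim_order_gt0 zn.
have [z1 zc] := prim_root_conj _ _ n0 zn.
have z0 : z != 0 by rewrite -normr_eq0 z1 oner_eq0.
pose w := z ^+ i / z ^+ j.
have -> : \sum_(k < n) (z ^+ k) ^+ i * ((z ^+ k) ^+ j)^* = \sum_(k < n) w ^+ k.
  apply: eq_bigr => k _; rewrite !rmorphXn /= zc /w.
  by rewrite !exprMn !exprVn -!exprM mulnC [(k * j)%N]mulnC.
have [eij|ij] := eqVneq i j.
  rewrite /w eij divff ?expf_neq0 // (eq_bigr (fun=> 1)) => [|k _]; last by rewrite expr1n.
  by rewrite sumr_const card_ord mul1r.
rewrite mul0r; have w1 : w != 1.
  apply: contraNneq ij => /(congr1 (fun x => x * z ^+ j)).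
  rewrite mul1r mulfVK ?expf_neq0 // => /eqP.
  by rewrite (eq_prim_root_expr zn) !modn_small.
(* Multiplied by [w - 1], the geometric sum becomes [w^n - 1 = 0]. *)
apply: (mulfI (x := w - 1)); first by rewrite subr_eq0.
rewrite mulr0 -subrX1 /w exprMn exprVn -!exprM mulnC exprM.
by rewrite (prim_expr_order zn) [(j * n)%N]mulnC exprM (prim_expr_order zn)
  !expr1n divr1 subrr.
Qed.

(** Orthogonality of the powers leaves only the diagonal of the double sum; the size condition keeps
    distinct exponents distinct modulo [n]. *)
Lemma parseval (n : nat) z r : n.-primitive_root z -> (size r <= n)%N ->
  \sum_(k < n) cabs r.[z ^+ k] ^+ 2 = n%:R * \sum_(j < n) cabs r`_j ^+ 2.
Proof.
move=> zn sr; apply: complexI; rewrite rmorphM !rmorph_sum /= rmorph_nat.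
have e (k : 'I_n) : (cabs r.[z ^+ k] ^+ 2)%:C = \sum_(i < n) \sum_(j < n)
    r`_i * (r`_j)^* * ((z ^+ k) ^+ i * ((z ^+ k) ^+ j)^*).
  rewrite -mul_conj (horner_coef_wide _ sr) rmorph_sum big_distrlr /=.
  apply: eq_bigr => i _; apply: eq_bigr => j _.
  by rewrite rmorphM mulrACA.
rewrite (eq_bigr _ (fun k _ => e k)).
rewrite exchange_big mulr_sumr; apply: eq_bigr => i _ /=.
rewrite exchange_big (bigD1 i) //= [X in _ + X]big1 ?addr0 => [|j ji].
  by rewrite -mulr_sumr sum_prim_root // eqxx mul1r mul_conj mulrC.
by rewrite -mulr_sumr sum_prim_root // eq_sym (negPf ji) mul0r mulr0.
Qed.

(** The bound on [q] compares the mean squares of [q * r] and [r] over the roots of unity, and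
    Parseval turns these into coefficient sums. Truncating [q * r] below degree [d] only decreases
    its sum. *)
Lemma von_neumann_coef q r (B : R) (d : nat) : (size r <= d)%N ->
  (forall z, `|z| = 1 -> cabs q.[z] <= B) ->
  \sum_(j < d) cabs (q * r)`_j ^+ 2 <= B ^+ 2 * \sum_(j < d) cabs r`_j ^+ 2.
Proof.
(* Large enough for Parseval to apply to [q * r], and positive in every case. *)
move=> sr qB; pose n := (size q + d).+1.
have [z zn] := prim_root_exists C n isT.
have z1 k : `|z ^+ k| = 1.
  by have [z1 _] := prim_root_conj _ _ (prim_order_gt0 zn) zn; rewrite normrX z1 expr1n.
have dn : (d <= n)%N by apply: leqW; exact: leq_addl.
have s_qr : (size (q * r)%R <= n)%N.
  apply: leq_trans (size_polyMleq _ _) _; apply: leq_trans (leq_pred _) _.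
  by apply: leqW; rewrite leq_add2l.
have widen (p : {poly C}) :
    \sum_(j < d) cabs p`_j ^+ 2 <= \sum_(j < n) cabs p`_j ^+ 2.
  rewrite (big_ord_widen n (fun j => cabs p`_j ^+ 2) dn) big_mkcond /=.
  by apply: ler_sum => i _; case: ifP => // _; exact: sqr_ge0.
have rd : \sum_(j < n) cabs r`_j ^+ 2 = \sum_(j < d) cabs r`_j ^+ 2.
  rewrite [RHS](big_ord_widen n (fun j => cabs r`_j ^+ 2) dn) [RHS]big_mkcond /=.
  apply: eq_bigr => i _; case: ltnP => // di.
  by rewrite nth_default ?(leq_trans sr) // /cabs normr0 expr0n.
apply: le_trans (widen _) _; rewrite -rd.
rewrite -(ler_pM2l (x := n%:R)) ?ltr0Sn // -(parseval _ _ _ zn s_qr).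
rewrite mulrCA -(parseval _ _ _ zn (leq_trans sr dn)) mulr_sumr.
apply: ler_sum => k _; rewrite hornerM cabsM exprMn.
apply: ler_wpM2r; first exact: sqr_ge0.
rewrite ler_sqr ?nnegrE ?cabs_ge0 ?qB //.
by apply: le_trans (qB _ (z1 0)); exact: cabs_ge0.
Qed.

End Parseval.

(** * Continuity and compactness, for the existence of the maximum *)

Section ContinuousComplex.
Variables (R : realType) (T : topologicalType).
Notation C := R[i].
Implicit Types (g h : T -> C) (c : C).

(** Continuity by parts, so that only the topology of [R] enters. *)
Definition continuousC g :=
  continuous (fun x => Re (g x)) /\ continuous (fun x => Im (g x)).

Lemma continuousC_cst c : continuousC (fun=> c).
Proof. by split=> x; exact: cvg_cst. Qed.

Lemma continuousC_conj g : continuousC g -> continuousC (fun x => (g x)^*).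
Proof.
move=> [cr ci]; split=> x.
  have -> : (fun x => Re (g x)^*) = (fun x => Re (g x)).
    by apply/funext => y; case: (g y).
  exact: cr.
have -> : (fun x => Im (g x)^*) = (fun x => - Im (g x)).
  by apply/funext => y; case: (g y).
by apply: cvgN; exact: ci.
Qed.

Lemma continuousC_add g h :
  continuousC g -> continuousC h -> continuousC (fun x => g x + h x).
Proof.
move=> [gr gi] [hr hi]; split=> x.
  have -> : (fun x => Re (g x + h x)) = (fun x => Re (g x) + Re (h x)).
    by apply/funext => y; case: (g y) (h y) => [? ?] [].
  by apply: cvgD; [exact: gr | exact: hr].
have -> : (fun x => Im (g x + h x)) = (fun x => Im (g x) + Im (h x)).
  by apply/funext => y; case: (g y) (h y) => [? ?] [].
by apply: cvgD; [exact: gi | exact: hi].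
Qed.

Lemma continuousC_mul g h :
  continuousC g -> continuousC h -> continuousC (fun x => g x * h x).
Proof.
move=> [gr gi] [hr hi]; split=> x.
  have -> : (fun x => Re (g x * h x)) =
      (fun x => Re (g x) * Re (h x) - Im (g x) * Im (h x)).
    by apply/funext => y; case: (g y) (h y) => [? ?] [].
  by apply: cvgB; apply: cvgM; [exact: gr | exact: hr | exact: gi | exact: hi].
have -> : (fun x => Im (g x * h x)) =
    (fun x => Re (g x) * Im (h x) + Im (g x) * Re (h x)).
  by apply/funext => y; case: (g y) (h y) => [? ?] [].
by apply: cvgD; apply: cvgM; [exact: gr | exact: hi | exact: gi | exact: hr].
Qed.

Lemma continuousC_horner (p : {poly C}) g :
  continuousC g -> continuousC (fun x => p.[g x]).
Proof.
move=> cg; elim/poly_ind: p => [|p c IH].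
  have -> : (fun x => (0 : {poly C}).[g x]) = (fun=> 0).
    by apply/funext => x; rewrite horner0.
  exact: continuousC_cst.
have -> : (fun x => (p * 'X + c%:P).[g x]) = (fun x => p.[g x] * g x + c).
  by apply/funext => x; rewrite hornerMXaddC.
by apply: continuousC_add; [exact: continuousC_mul | exact: continuousC_cst].
Qed.

Lemma continuous_cabs g : continuousC g -> continuous (fun x => cabs (g x)).
Proof.
move=> [gr gi] x.
have -> : (fun x => cabs (g x)) =
    (fun x => Num.sqrt (Re (g x) ^+ 2 + Im (g x) ^+ 2)).
  by apply/funext => y; rewrite -cabs_sqr sqrtr_sqr ger0_norm ?cabs_ge0.
apply: (@continuous_comp _ _ _ (fun x => Re (g x) ^+ 2 + Im (g x) ^+ 2) Num.sqrt).
  by apply: cvgD; apply: cvgM; (exact: gr || exact: gi).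
exact: sqrt_continuous.
Qed.

End ContinuousComplex.

Arguments continuousC {R T}.

(** The sphere is a closed subset of the compact cube [[-1, 1]^n]. *)
Lemma sphere_compact (R : realType) (n : nat) :
  compact [set x : 'rV[R]_n | \sum_(i < n) x ord0 i ^+ 2 = 1].
Proof.
pose cube := [set x : 'rV[R]_n | forall i, x ord0 i \in `[- 1, 1 : R]].
apply: (@subclosed_compact _ _ cube).
- have -> : [set x : 'rV[R]_n | \sum_(i < n) x ord0 i ^+ 2 = 1] =
      (fun x : 'rV[R]_n => \sum_(i < n) x ord0 i ^+ 2) @^-1` [set 1] by [].
  apply: preimage_closed; last exact: closed_eq.
  have cs : continuous (fun x : 'rV[R]_n => \sum_(i < n) x ord0 i ^+ 2).
    apply: continuous_big => [|i _]; first exact: add_continuous.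
    have cq : continuous (fun y : 'rV[R]_n => y ord0 i ^+ 2).
      move=> x; apply: (@continuous_comp _ _ _ (fun y : 'rV[R]_n => y ord0 i)
        (fun r : R => r ^+ 2)); first exact: coord_continuous.
      exact: exprn_continuous.
    exact: cq.
  by move=> x _; exact: cs.
- apply: (@rV_compact _ _ (fun=> `[- 1, 1 : R]%classic)).
  by move=> _; apply: segment_compact.
- move=> x /= x1 i; rewrite in_itv /= -ler_norml.
  rewrite -(@expr_le1 _ 2) ?normr_ge0 // real_normK ?num_real // -x1.
  by rewrite (bigD1 i) //= lerDl sumr_ge0 // => j _; exact: sqr_ge0.
Qed.

(** * The compressed shift in coordinates *)

Section CompressedShift.
Variable R : realType.
Notation C := R[i].
Implicit Types (f g h : nat -> C) (z w c : C) (P p q : {poly C}).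
Variables (a lambda : C) (Theta : C -> C).
Hypothesis a_disk : disk a.
Hypothesis lambda1 : `|lambda| = 1.
Hypothesis ThetaE : forall z, disk z ->
  Theta z = lambda * ((z - a) / (1 - a^* * z)) ^+ 3.

Let K := model_space Theta.
Let A := compressed_shift Theta.
Let K_E := model_spaceE _ a a_disk Theta lambda lambda1 ThetaE.
Let t : C := 1 - a * a^*.

Lemma model_space_emb f : K f <-> exists c0 c1 c2, f = emb a c0 c1 c2.
Proof.
split=> [/K_E[hf /(back_sub3_emb_exists _ _ a_disk)]//|[c0 [c1 [c2 ->]]]].
by apply/K_E; split; [exact: hardy_emb | exact: back_sub3_emb].
Qed.

Lemma shift_subZ c f : shift_sub a (c *: f) = c *: shift_sub a f.
Proof. by rewrite /shift_sub mulzZ scalerBr !scalerA mulrC. Qed.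

Lemma embB c0 c1 c2 d0 d1 d2 :
  emb a c0 c1 c2 - emb a d0 d1 d2 = emb a (c0 - d0) (c1 - d1) (c2 - d2).
Proof.
rewrite /emb; move: (_ *: sub_shift _ (sub_shift _ _)) => e0.
move: (_ *: shift_sub _ (sub_shift _ _)) => e1.
move: (_ *: shift_sub _ (shift_sub _ _)) => e2.
by apply/funext => n; rewrite !(add_at, opp_at, scale_at); ring.
Qed.

(** By [mulz_emb] the shifted vector minus the right-hand side lies in [Theta H^2], so the
    right-hand side is its projection. *)
Lemma compressed_shift_emb c0 c1 c2 : A (emb a c0 c1 c2) =
  emb a (a * c0) (a * c1 + t * c0) (a * c2 + t * c1 - t * a^* * c0).
Proof.
set g := (X in _ = X); have Kg : K g by apply/model_space_emb; do 3!eexists.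
have hf d0 d1 d2 : hardy (emb a d0 d1 d2) := hardy_emb _ _ a_disk _ _ _.
pose m := mulz (emb a c0 c1 c2); have hm : hardy m := hardy_mulz _ _ (hf _ _ _).
have orth h : K h -> hdot (m - g) h = 0.
  move=> [hh kh]; pose v := kern_scale a * (a^* ^+ 2 * c0 - a^* * c1 + c2) *: cubic_kern a.
  have hv : hardy v by apply: hardyZ; exact: hardy_u.
  have -> : m - g = shift_sub a (shift_sub a (shift_sub a v)).
    rewrite /m mulz_emb -/t -/g addrC addKr /v.
    by rewrite !shift_subZ.
  rewrite hdotC ?kh ?conjC0 //; last by do 3!apply: hardy_shift_sub.
  by apply/(mul_imageE _ a a_disk Theta lambda lambda1 ThetaE); exists v.
(* The choice made by [xget] is pinned down by uniqueness: two candidates differ by an element of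
   [K] orthogonal to [K], hence to itself. *)
rewrite /A /compressed_shift /orthoproj; apply: xget_unique => [|y [Ky yP]].
  by split.
have /model_space_emb[y0 [y1 [y2 yE]]] := Ky.
have Kd : K (y - g) by rewrite yE embB; apply/model_space_emb; do 3!eexists.
have hy : hardy y by rewrite yE.
have hd : hardy (y - g) by apply: hardyB => //; exact: hf.
apply/eqP; rewrite -subr_eq0; apply/eqP; apply: hdot_eq0 => //.
have hmg : hardy (m - g) by apply: hardyB => //; exact: hf.
have hmy : hardy (m - y) by exact: hardyB.
rewrite {1}(_ : y - g = (m - g) - (m - y)); last first.
  by rewrite opprB addrCA addrAC subrr add0r addrC.
by rewrite hdotBl // (orth _ Kd) (yP _ Kd) subrr.
Qed.

(** * Similarity with [kappa] of the nilpotent shift *)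

Let r2 : C := (Num.sqrt 2)%:C.

Lemma r2_sqr : r2 * r2 = 2.
Proof. by rewrite -rmorphM /= -expr2 sqr_sqrtr // rmorph_nat. Qed.

Lemma r2_neq0 : r2 != 0.
Proof.
by apply: contra_eq_neq r2_sqr => ->; rewrite mul0r eq_sym pnatr_eq0.
Qed.

Lemma conj_r2 : r2^* = r2.
Proof. by apply: conj_Creal; apply/complex_realP; eexists. Qed.

(* The vector with coordinates [X (P_0, P_1, P_2)] in the basis [e_j]. *)
Definition polyemb P : nat -> C :=
  emb a P`_0 (r2 * P`_1) (2 * P`_2 - a^* / r2 * P`_1).

Definition kappa : {poly C} :=
  a%:P + (t / r2) *: 'X - (t * a^* / 4) *: 'X^2.

Lemma polyembE P n : polyemb P n =
  P`_0 * emb a 1 0 0 n + P`_1 * emb a 0 r2 (- (a^* / r2)) n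
  + P`_2 * emb a 0 0 2 n.
Proof. by rewrite /polyemb /emb !(add_at, opp_at, scale_at); ring. Qed.

Lemma coef_kappaM (b c : C) P : let q := (a%:P + b *: 'X - c *: 'X^2) * P in
  [/\ q`_0 = a * P`_0, q`_1 = a * P`_1 + b * P`_0 &
      q`_2 = a * P`_2 + b * P`_1 - c * P`_0].
Proof.
rewrite /= mulrBl mulrDl -!scalerAl mul_polyC.
by rewrite !(coefB, coefD, coefZ, coefXM, coefXnM) /=; split; ring.
Qed.

(** The intertwining relation of [X]. Its diagonal [1, sqrt 2, 2] carries [N / sqrt 2] to [N] and
    [N^2] to [2 N^2]; the off-diagonal entry supplies the missing half of [conj a N^2]. *)
Lemma compressed_shift_polyemb P : A (polyemb P) = polyemb (kappa * P).
Proof.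
rewrite /polyemb compressed_shift_emb.
have [-> -> ->] := coef_kappaM (t / r2) (t * a^* / 4) P.
have r0 := r2_neq0; have rr := r2_sqr; move: t => b.
congr emb.
- transitivity (a * (r2 * P`_1) + b / r2 * r2 * P`_0); first by field.
  by field.
- have vv : r2^-1 * r2^-1 = 2^-1 by rewrite -invfM rr.
  have r2v : 2 * r2^-1 = r2 by rewrite -rr mulfK.
  (* The two halves stay apart: [2^-1] comes from the quadratic term of [kappa], [r2^-1 * r2^-1]
     from the off-diagonal entry of [X]. *)
  transitivity (2 * (a * P`_2) + b * (2 * r2^-1) * P`_1 - a^* / r2 * a * P`_1
    - b * a^* * (2^-1 + r2^-1 * r2^-1) * P`_0); last by field.
  by rewrite vv r2v; field.
Qed.

(** Iteration of the intertwining relation, then linearity; [polyemb] reads three coefficients only,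
    which is the reduction modulo [z^3]. *)
Lemma poly_op_polyemb p P : poly_op p A (polyemb P) = polyemb ((p \Po kappa) * P).
Proof.
have it k : iter k A (polyemb P) = polyemb (kappa ^+ k * P).
  elim: k => [|k IH]; first by rewrite expr0 mul1r.
  by rewrite iterS IH compressed_shift_polyemb mulrA -exprS.
apply/funext => n; rewrite /poly_op comp_polyE mulr_suml.
under eq_bigr do rewrite it.
rewrite (big_morph (fun Q => polyemb Q n) (id1 := 0) (op1 := +%R)).
- by apply: eq_bigr => k _; rewrite -scalerAl !polyembE !coefZ; ring.
- by move=> P1 P2; rewrite !polyembE !coefD; ring.
- by rewrite polyembE !coef0; ring.
Qed.

(** Surjectivity of [X]: the triangular system is solved by forward substitution. *)
Lemma emb_polyemb c0 c1 c2 :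
  exists2 P : {poly C}, (size P <= 3)%N & emb a c0 c1 c2 = polyemb P.
Proof.
exists (Poly [:: c0; c1 / r2; (c2 + a^* / r2 * (c1 / r2)) / 2]).
  exact: size_Poly.
have r0 := r2_neq0.
by rewrite /polyemb !coef_Poly /=; congr emb; field.
Qed.

Lemma hnorm_emb c0 c1 c2 : hnorm (emb a c0 c1 c2) =
  Num.sqrt (cabs c0 ^+ 2 + cabs c1 ^+ 2 + cabs c2 ^+ 2).
Proof.
rewrite hnorm_hdot; last exact: hardy_emb.
by rewrite hdot_emb // !mul_conj.
Qed.

Lemma cabs_offdiag y : cabs (a^* / r2 * y) ^+ 2 <= cabs y ^+ 2 / 2.
Proof.
rewrite !cabsM cabs_conj !exprMn mulrAC mulrC; move/diskE: a_disk => a1.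
have -> : cabs r2^-1 ^+ 2 = 2^-1.
  apply: complexI; rewrite -mul_conj fmorphV /= conj_r2 -invfM r2_sqr.
  by rewrite fmorphV rmorph_nat.
rewrite mulrC ler_pM2r ?invr_gt0 // ler_piMl ?sqr_ge0 //.
by rewrite expr_le1 ?cabs_ge0 // ltW.
Qed.

(** With [x = P_2] and [w] the off-diagonal term, [cabs_offdiag] gives [|P_1|^2 >= 2 |w|^2], and [|2
    x - w|^2 + 2 |w|^2 - |x|^2 = 2 |x - w|^2 + |x|^2 + |w|^2]. *)
Lemma hnorm_polyemb_ge P :
  \sum_(j < 3) cabs P`_j ^+ 2 <= hnorm (polyemb P) ^+ 2.
Proof.
rewrite /polyemb hnorm_emb sqr_sqrtr ?addr_ge0 ?sqr_ge0 //.
rewrite !big_ord_recl big_ord0 addr0 /= /bump /= !add1n cabsM exprMn.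
have -> : cabs r2 ^+ 2 = 2.
  by apply: complexI; rewrite -mul_conj conj_r2 r2_sqr rmorph_nat.
move: (cabs_offdiag P`_1); move: (a^* / r2 * _) => w.
rewrite !cabs_sqr; case: (P`_0) (P`_1) (P`_2) w => [p p'] [q q'] [x x'] [w w'] /=.
move=> h; have := sqr_ge0 (x - w); have := sqr_ge0 (x' - w').
have := sqr_ge0 x; have := sqr_ge0 x'; have := sqr_ge0 w; have := sqr_ge0 w'.
nra.
Qed.

(* The quadratic form in [key] is degenerate, which is where the constant comes from. *)
Lemma hnorm_polyemb_le P : hnorm (polyemb P) ^+ 2 <=
  (13 + Num.sqrt 41) / 4 * \sum_(j < 3) cabs P`_j ^+ 2.
Proof.
rewrite /polyemb hnorm_emb sqr_sqrtr ?addr_ge0 ?sqr_ge0 //.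
rewrite !big_ord_recl big_ord0 addr0 /= /bump /= !add1n cabsM exprMn.
have -> : cabs r2 ^+ 2 = 2.
  by apply: complexI; rewrite -mul_conj conj_r2 r2_sqr rmorph_nat.
have s0 : 0 <= Num.sqrt 41 :> R := sqrtr_ge0 _.
have ss : Num.sqrt 41 ^+ 2 = 41 :> R by rewrite sqr_sqrtr.
move: (Num.sqrt 41) s0 ss => s s0 ss; have s3 : 3 <= s by nra.
have key (x w : R) : (2 * x - w) ^+ 2 <=
    (13 + s) / 4 * x ^+ 2 + (s + 5) / 2 * w ^+ 2.
  rewrite -subr_ge0.
  have -> : (13 + s) / 4 * x ^+ 2 + (s + 5) / 2 * w ^+ 2 - (2 * x - w) ^+ 2 =
    (s - 3) / 4 * (x + (s + 3) / 4 * w) ^+ 2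
    + (41 - s ^+ 2) * (x * w / 8 + (s + 3) / 64 * w ^+ 2) by field.
  by rewrite ss subrr mul0r addr0 mulr_ge0 ?sqr_ge0 // divr_ge0 // subr_ge0.
move: (cabs_offdiag P`_1); move: (a^* / r2 * _) => w.
rewrite !cabs_sqr; case: (P`_0) (P`_1) (P`_2) w => [p p'] [q q'] [x x'] [w w'] /=.
move=> h; have := key x w; have := key x' w'.
(* The resulting [(s + 5) / 4] and the weight [2] of the middle coordinate add up to exactly
   [(13 + s) / 4]. *)
have : (s + 5) / 2 * (w ^+ 2 + w' ^+ 2) <= (s + 5) / 2 * ((q ^+ 2 + q' ^+ 2) / 2).
  by rewrite ler_wpM2l // divr_ge0 // addr_ge0.
have := mulr_ge0 s0 (sqr_ge0 p); have := mulr_ge0 s0 (sqr_ge0 p').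
have := sqr_ge0 p; have := sqr_ge0 p'.
nra.
Qed.

(** * The curve in the numerical range and the norm bound *)

Lemma kappa_numerical_range z : `|z| = 1 ->
  numerical_range K A kappa.[z].
Proof.
move=> z1; have zz : z * z^* = 1 by rewrite -normCK z1 expr1n.
have r0 := r2_neq0; have rr := r2_sqr.
have cz : cabs z ^+ 2 = 1 by apply: complexI; rewrite -mul_conj zz rmorph1.
have cr : cabs r2^-1 ^+ 2 = 2^-1.
  apply: complexI; rewrite -mul_conj fmorphV /= conj_r2 -invfM r2_sqr.
  by rewrite fmorphV rmorph_nat.
have c2 : cabs (2^-1 : C) ^+ 2 = 4^-1.
  apply: complexI; rewrite -mul_conj fmorphV /= conjC_nat -invfM -natrM.
  by rewrite fmorphV rmorph_nat.
exists (emb a 2^-1 (z^* / r2) (z^* * z^* / 2)).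
  split; first by apply/model_space_emb; do 3!eexists.
  rewrite hnorm_emb !cabsM !exprMn cabs_conj cz cr c2 !mul1r.
  by rewrite (_ : _ + _ = 1) ?sqrtr1 //; field.
rewrite compressed_shift_emb hdot_emb // /kappa.
rewrite !hornerE.
rewrite !(rmorphM, fmorphV) /= !(conjCK, conj_r2, conjC_nat).
(* The squared moduli [1/4, 1/2, 1/4] sum to [1]; the two neighbouring products each give
   [t z / (2 sqrt 2)], and the outer one gives [- t conj a z^2 / 4]. *)
transitivity (a * (4^-1 + (z * z^*) / (r2 * r2) + (z * z^*) ^+ 2 / 4)
  + t * z / r2 * (1 + z * z^*) / 2 - t * a^* * z ^+ 2 / 4).
  by field.
by rewrite zz rr; field.
Qed.

(** For [f = X P] with [|f| <= 1] and [q = p \Po kappa], the chain is [|p(A) f|^2 <= c^2 |q P|^2 <=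
    c^2 B^2 |P|^2 <= c^2 B^2 |f|^2], the polynomial norms being taken on coefficients below degree
    [3]. *)
Lemma opnorm_le p (B : R) :
  (forall z, numerical_range K A z -> cabs p.[z] <= B) ->
  (opnorm K (poly_op p A) <= (Num.sqrt (13 + Num.sqrt 41) / 2 * B)%:E)%E.
Proof.
move=> pB; have B0 : 0 <= B.
  by apply: le_trans (pB _ (kappa_numerical_range 1 (normr1 _))); exact: cabs_ge0.
apply: ge_ereal_sup => _ [f [/model_space_emb[c0 [c1 [c2 ->]]] f1] <-].
rewrite lee_fin; have [P sP eP] := emb_polyemb c0 c1 c2.
rewrite eP in f1 *; rewrite poly_op_polyemb.
have s0 : 0 <= 13 + Num.sqrt 41 :> R by rewrite addr_ge0 ?sqrtr_ge0.
have h0 (g : nat -> C) : 0 <= hnorm g :> R by exact: sqrtr_ge0.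
rewrite -ler_sqr ?nnegrE ?mulr_ge0 ?sqrtr_ge0 // !exprMn (sqr_sqrtr s0).
apply: le_trans (hnorm_polyemb_le _) _.
have -> : 2^-1 ^+ 2 = 4^-1 :> R by rewrite exprVn -natrX.
apply: ler_wpM2l; first by rewrite divr_ge0.
apply: le_trans (von_neumann_coef _ _ _ B _ sP _) _.
  by move=> z z1; rewrite horner_comp; apply/pB/kappa_numerical_range.
rewrite -[leRHS]mulr1; apply: ler_wpM2l; first exact: sqr_ge0.
by apply: le_trans (hnorm_polyemb_ge _) _; rewrite expr_le1.
Qed.

(** * Attainment of the maximum over the numerical range *)

Let coord (x : 'rV[R]_6) (k : nat) : C :=
  x ord0 (inord k.*2) +i* x ord0 (inord k.*2.+1).

(** This is [hdot (A f) f] for [f] with coordinates [c0, c1, c2], written with sums, products,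
    conjugates and constants only, so that its continuity follows by structure. *)
Let form c0 c1 c2 : C := a * c0 * c0^* + (a * c1 + t * c0) * c1^*
  + (a * c2 + t * c1 + - (t * a^*) * c0) * c2^*.

(** As [emb] is isometric, the unit vectors of [K] correspond to the real unit sphere in six
    coordinates. *)
Lemma numerical_rangeE w : numerical_range K A w <->
  exists2 x : 'rV[R]_6, \sum_(i < 6) x ord0 i ^+ 2 = 1 &
    w = form (coord x 0) (coord x 1) (coord x 2).
Proof.
have E c0 c1 c2 : hdot (A (emb a c0 c1 c2)) (emb a c0 c1 c2) = form c0 c1 c2.
  by rewrite compressed_shift_emb // hdot_emb // /form mulNr.
have N x : hnorm (emb a (coord x 0) (coord x 1) (coord x 2)) =
    Num.sqrt (\sum_(i < 6) x ord0 i ^+ 2).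
  rewrite hnorm_emb // !cabs_sqr /= !big_ord_recl big_ord0 /=; congr Num.sqrt.
  rewrite !addr0 !addrA; congr (_ ^+ 2 + _ ^+ 2 + _ ^+ 2 + _ ^+ 2 + _ ^+ 2 + _ ^+ 2);
    by congr (x ord0 _); apply/val_inj; rewrite /= inordK.
split=> [[f [Kf f1] <-]|[x x1 ->]]; last first.
  exists (emb a (coord x 0) (coord x 1) (coord x 2)); last exact: E.
  split; last by rewrite N x1 sqrtr1.
  by apply/model_space_emb; do 3!eexists.
have [c0 [c1 [c2 fE]]] := (model_space_emb f).1 Kf.
pose x : 'rV[R]_6 := \row_(i < 6)
  [:: Re c0; Im c0; Re c1; Im c1; Re c2; Im c2]`_i.
have xc : [/\ coord x 0 = c0, coord x 1 = c1 & coord x 2 = c2].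
  by rewrite /coord !mxE !inordK //=; case: (c0) (c1) (c2) => [? ?] [? ?] [].
have [x0 x1 x2] := xc; exists x; last by rewrite x0 x1 x2 fE E.
move: f1; rewrite fE -{1}x0 -{1}x1 -{1}x2 N => /(congr1 (fun r => r ^+ 2)).
by rewrite sqr_sqrtr ?expr1n // sumr_ge0 // => i _; exact: sqr_ge0.
Qed.

(** The extreme value theorem for the continuous function [F] on the compact sphere that
    parametrizes the numerical range. *)
Lemma numerical_range_max (p : {poly C}) :
  exists M, is_max [set cabs p.[z] | z in numerical_range K A] M.
Proof.
have ccoord k : continuousC (fun x : 'rV[R]_6 => coord x k).
  by split; exact: coord_continuous.
have cform : continuousC (fun x : 'rV[R]_6 =>
    form (coord x 0) (coord x 1) (coord x 2)).
  by rewrite /form; repeat first [apply: continuousC_add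
    | apply: continuousC_mul | exact: continuousC_cst | exact: ccoord
    | apply: continuousC_conj].
pose F (x : 'rV[R]_6) := cabs p.[form (coord x 0) (coord x 1) (coord x 2)].
have cF : continuous F by apply/continuous_cabs/continuousC_horner.
pose S := [set x : 'rV[R]_6 | \sum_(i < 6) x ord0 i ^+ 2 = 1].
have S0 : S !=set0.
  exists (delta_mx ord0 ord0); rewrite /S /= (bigD1 ord0) //= big1 => [|i i0].
    by rewrite mxE !eqxx expr1n addr0.
  by rewrite mxE (negPf i0) andbF expr0n.
have [x xS xmax] := EVT_max_rV S0 (sphere_compact R 6)
  (continuous_subspaceT cF).
exists (F x); split.
  exists (form (coord x 0) (coord x 1) (coord x 2)) => //.
  by apply/numerical_rangeE; exists x => //; move: xS; rewrite inE.
by move=> _ [w /numerical_rangeE[y y1 ->] <-]; apply: xmax; rewrite inE.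
Qed.

End CompressedShift.

Theorem proposition5p6 (R : realType) (Theta : R[i] -> R[i])
    (hTheta : unicritical_blaschke 3 Theta) (p : {poly R[i]}) :
  exists M : R,
    is_max [set cabs p.[z] | z in numerical_range (model_space Theta)
                                    (compressed_shift Theta)] M /\
    (opnorm (model_space Theta) (poly_op p (compressed_shift Theta))
      <= (Num.sqrt (13 + Num.sqrt 41) / 2 * M)%:E)%E.
Proof.
case: hTheta => a [lambda [da l1 ThetaE]].
have [M Mmax] := numerical_range_max _ a lambda _ da l1 ThetaE p.
exists M; split=> //; apply: (opnorm_le _ a lambda) => // z Wz.
by apply: Mmax.2; exists z.
Qed.
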